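(* Let $\alpha$ be a real number with $2 < \alpha \leq \frac{7}{3}$. Then the number of binary words of length $n$ (words in $\{0,1\}^*$ of length $n$) that avoid $\alpha$-powers is $O(n^{\log_2 25}) = O(n^{4.644})$ as $n \to \infty$.
   Context: For a word $w$, $|w|$ denotes its length. A word $v$ is a factor of a word $x$ if $x = uvw$ for some (possibly empty) words $u,w$. For a rational number $\beta \geq 1$, a nonempty word $w$ is a $\beta$-power if there exist a nonempty word $y$, a prefix $y'$ of $y$, and an integer $n \ge 0$ such that $w = y^n y'$ and $n + |y'|/|y| = \beta$. For a real number $\alpha$, a word avoids $\alpha$-powers (is $\alpha$-power-free) if it contains no factor that is a $\beta$-power for any rational $\beta \geq \alpha$. *)

(* Defs.v *)
From mathcomp Require Import all_boot all_order all_algebra.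
From mathcomp Require Import boolp classical_sets reals.

Set Implicit Arguments.
Unset Strict Implicit.
Unset Printing Implicit Defensive.

Import Order.TTheory GRing.Theory Num.Theory.
Local Open Scope ring_scope.

(* The prefix [y'] may be empty or all of [y]; [n] may be [0]. *)
Definition is_power (A : eqType) (beta : rat) (w : seq A) : Prop :=
  [/\ 1 <= beta, w != [::] &
      exists (y y' : seq A) (n : nat),
        [/\ y != [::], prefix y' y, w = flatten (nseq n y) ++ y' &
            n%:R + (size y')%:R / (size y)%:R = beta]].

Definition avoids_powers (R : realType) (A : eqType) (alpha : R) (x : seq A) :
    Prop :=
  forall (v : seq A) (beta : rat),
    infix v x -> alpha <= ratr beta -> ~ is_power beta v.

Definition num_avoiding (R : realType) (A : finType) (alpha : R) (n : nat) :
    nat :=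
  #|[pred w : n.-tuple A | `[< avoids_powers alpha w >]]|.

Arguments num_avoiding {R} A alpha n.

(* Main.v *)
Require Import Defs.
From mathcomp Require Import all_boot all_order all_algebra.
From mathcomp Require Import all_classical all_reals all_analysis.
From mathcomp Require Import zify lra.
Import Order.TTheory GRing.Theory Num.Theory.
Import numFieldNormedType.Exports.
Set Implicit Arguments.
Unset Strict Implicit.
Unset Printing Implicit Defensive.
Local Open Scope classical_set_scope.
Local Open Scope ring_scope.

(** The bound rests on the fact that 7/3-power-free binary words are, up to
    short ends, images of the Thue-Morse morphism mu (0 -> 01, 1 -> 10).

    Mark every place where two consecutive letters of such a word x agree.
    Absence of cubes [a a a] and of [a b a b a] forces consecutive marks to be
    2, 3 or 4 letters apart.  A gap of 3 is a factor [a a b a a]; an inner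
    occurrence extends on both sides to [b a a b a a b], a power of exponent
    exactly 7/3.  So a gap of 3 occurs only at the very beginning or at the
    very end of x, all other gaps are even, and x can be cut into blocks of
    length 2 in such a way that no block has two equal letters: these blocks
    form a word mu(y), and only an end among [], [0], [1], [0 0], [1 1] is left
    over on each side.  This is [avoids_powers_factorization]; its heart is
    [aligned_after].

    As mu doubles lengths and preserves exponents, y again avoids
    alpha-powers, and its length is at most half of that of x.  The 5 * 5
    choices of ends give N(n) <= 25 * max (N(k) | k <= n / 2)
    ([num_avoiding_le]), hence N(n) <= 25 ^ k as soon as n < 2 ^ k, and
    25 ^ k is at most 25 * n ^ (log_2 25) for the least such k.  The numerical
    exponent follows from 25 ^ 250 <= 2 ^ 1161, since 1161 / 250 = 4.644. *)

(** * Words without short powers *)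

Fixpoint thue_morse (y : seq bool) : seq bool :=
  if y is a :: y' then [:: a, ~~ a & thue_morse y'] else [::].

Definition ends : seq (seq bool) :=
  [:: [::]; [:: false]; [:: true]; [:: false; false]; [:: true; true]].

(** Exponents 3, 5/2 and 7/3: the only powers whose absence the factorization
    uses. *)
Definition short_power_free (x : seq bool) : Prop :=
  forall a : bool,
  [/\ ~~ infix [:: a; a; a] x, ~~ infix [:: a; ~~ a; a; ~~ a; a] x &
      ~~ infix [:: ~~ a; a; a; ~~ a; a; a; ~~ a] x].

Lemma short_power_free_cons a x :
  short_power_free (a :: x) -> short_power_free x.
Proof.
by move=> Fx b; case: (Fx b); rewrite !infix_consl !negb_or;
  do 3![case/andP=> _ ?].
Qed.

(* A forbidden factor lying inside the explicit letters of the word makes one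
   of the components of [F] reduce to [~~ true]. *)
Ltac refute F := by case: (F true); case: (F false); rewrite /= ?prefix0s ?orbT.

Definition aligned (z : seq bool) : Prop :=
  exists y v, v \in ends /\ z = thue_morse y ++ v.

Lemma aligned_end v : v \in ends -> aligned v.
Proof. by exists [::], v. Qed.

Lemma aligned_cons a z : aligned z -> aligned [:: a, ~~ a & z].
Proof. by case=> y [v [v_end ->]]; exists (a :: y), v. Qed.

(** Two equal letters straddling a block boundary, as in [~c c][c ~c], keep the
    rest of the word aligned with the blocks.  A next block [~c ~c] creates a
    cube; a next block [c c] creates an inner [c c ~c c c], whence a 7/3-power
    as soon as one more letter follows, so that block is the right end of the
    word.  The next block [~c c] reproduces the situation with c and ~c
    exchanged.  After the next block [c ~c] the word reads [c ~c c ~c]: a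
    further letter [c] would create an exponent 5/2 and a block [~c ~c] a cube,
    so that the following block must be [~c c], with the same effect. *)
Lemma aligned_after c z :
  short_power_free [:: ~~ c, c, c, ~~ c & z] -> aligned z.
Proof.
have [n] := ubnP (size z); elim: n c z => // n IH c [|a [|b z]] /= le_zn F.
- exact: aligned_end.
- by apply: aligned_end; case: a {F}.
have [eq_ab|/negPf neq_ab] := eqVneq a b.
  subst b; case: z le_zn F => [|e z] _ F.
    by apply: aligned_end; case: a {F}.
  by case: c a e F => [] [] [] F; refute F.
have {neq_ab} ? : b = ~~ a by case: a b neq_ab {F} => [] [].
subst b; apply: aligned_cons.
have F2 : short_power_free [:: c, ~~ c, a, ~~ a & z].
  by do 2![apply: short_power_free_cons]; apply: F.
have [eq_ac|neq_ac] := eqVneq a c; last first.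
  have {neq_ac} ? : a = ~~ c by case: a c neq_ac {F F2} => [] [].
  subst a; apply: (IH (~~ c)); first by lia.
  by rewrite !negbK in F2 *.
subst a; case: z le_zn F F2 => [|e [|g z]] /= le_zn F F2.
- exact: aligned_end.
- by apply: aligned_end; case: e {F F2}.
have [? ?] : e = ~~ c /\ g = c.
  by case: c e g F {F2} => [] [] [] F //; exfalso; refute F.
subst e g; rewrite -{2}[c]negbK; apply: aligned_cons.
apply: (IH (~~ c)); first by lia.
by rewrite negbK; do 2![apply: short_power_free_cons]; apply: F2.
Qed.

(* Removes blocks from the front of the word until the end of the word is
   reached or [aligned_after] applies to some suffix of the word in [F]. *)
Ltac align F :=
  first [ exact: aligned_end
        | apply: (@aligned_after true); exact F
        | apply: (@aligned_after false); exact F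
        | apply: (@aligned_cons true); align F
        | apply: (@aligned_cons false); align F
        | let F' := fresh in have F' := short_power_free_cons F; align F' ].

Definition factored (x : seq bool) : Prop :=
  exists u z, [/\ u \in ends, aligned z & x = u ++ z].

Lemma factored_cat u z : u \in ends -> aligned z -> factored (u ++ z).
Proof. by exists u, z. Qed.

Ltac factor F :=
  first [ exfalso; refute F
        | apply: (@factored_cat [::]) => //; align F
        | apply: (@factored_cat [:: true]) => //; align F
        | apply: (@factored_cat [:: false]) => //; align F
        | apply: (@factored_cat [:: true; true]) => //; align F
        | apply: (@factored_cat [:: false; false]) => //; align F ].

(** Within its first 7 letters, a word without short powers either ends or
    shows two equal letters preceded and followed by the other letter; with the
    right choice of the left end these straddle a block boundary, and
    [aligned_after] deals with what follows.  The worst case is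
    [a a b a b b a]. *)
Lemma short_power_free_factored x : short_power_free x -> factored x.
Proof.
by move=> F; do 8?[first [by factor F | case: x F => [|[] x] F]].
Qed.

(** * Powers and the Thue-Morse morphism *)

Lemma thue_morse_cat y z : thue_morse (y ++ z) = thue_morse y ++ thue_morse z.
Proof. by elim: y => //= a y ->. Qed.

Lemma size_thue_morse y : size (thue_morse y) = (size y).*2.
Proof. by elim: y => //= a y ->. Qed.

Lemma thue_morse_flatten_nseq n y :
  thue_morse (flatten (nseq n y)) = flatten (nseq n (thue_morse y)).
Proof. by elim: n => //= n IH; rewrite thue_morse_cat IH. Qed.

(** The morphism doubles both the length of the period and that of the
    incomplete period, so the exponent does not change. *)
Lemma is_power_thue_morse beta v :
  is_power beta v -> is_power beta (thue_morse v).
Proof.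
case=> beta_ge1 v_neq0 [y [y' [n [y_neq0 /prefixP[s def_y] def_v def_beta]]]].
have neq0 w : w != [::] -> thue_morse w != [::] by case: w.
split; [by []|exact: neq0|].
exists (thue_morse y), (thue_morse y'), n; split; first exact: neq0.
- by apply/prefixP; exists (thue_morse s); rewrite def_y thue_morse_cat.
- by rewrite def_v thue_morse_cat thue_morse_flatten_nseq.
rewrite !size_thue_morse -!muln2 !natrM -mulf_div divff ?mulr1 //.
Qed.

Lemma avoids_powers_infix (R : realType) (alpha : R) (A : eqType)
    (v x : seq A) :
  infix v x -> avoids_powers alpha x -> avoids_powers alpha v.
Proof. by move=> vx avx w beta wv; apply: avx (infix_trans wv vx). Qed.

Lemma infix_thue_morse v y : infix v y -> infix (thue_morse v) (thue_morse y).
Proof.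
case/infixP=> p [s ->]; apply/infixP; exists (thue_morse p), (thue_morse s).
by rewrite !thue_morse_cat.
Qed.

Lemma avoids_powers_thue_morse (R : realType) (alpha : R) y :
  avoids_powers alpha (thue_morse y) -> avoids_powers alpha y.
Proof.
move=> avy v beta vy le_beta pv.
exact: avy (infix_thue_morse vy) le_beta (is_power_thue_morse pv).
Qed.

(** The exponent bound 7/3, with denominators cleared so that concrete words
    are handled by computation. *)
Lemma avoids_powers_notin (R : realType) (alpha : R) (A : eqType)
    (x y y' : seq A) n :
  alpha <= 7 / 3 -> avoids_powers alpha x -> y != [::] -> prefix y' y ->
  (7 * size y <= 3 * (n * size y + size y'))%N ->
  ~~ infix (flatten (nseq n y) ++ y') x.
Proof.
move=> le_alpha avx y_neq0 pre_y' le_size; apply/negP => inf.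
have y_gt0 : (0 < size y)%N by case: y y_neq0 {pre_y' le_size inf}.
pose beta : rat := n%:R + (size y')%:R / (size y)%:R.
have beta_ge : 7 / 3 <= beta.
  rewrite ler_pdivrMr // /beta -(ler_pM2r (x := (size y)%:R)) ?ltr0n //.
  rewrite mulrAC [in leRHS]mulrDl mulfVK ?pnatr_eq0 -?lt0n //.
  by rewrite -!natrM -natrD -natrM ler_nat [leqRHS]mulnC.
apply: avx inf _ _.
  apply: le_trans le_alpha _.
  have -> : 7 / 3 = ratr (7 / 3 : rat) :> R by rewrite fmorph_div /= !ratr_nat.
  by rewrite ler_rat; apply: beta_ge.
split; [by apply: le_trans beta_ge; lra| |by exists y, y', n].
by rewrite -size_eq0 size_cat size_flatten /shape map_nseq sumn_nseq; lia.
Qed.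

Lemma avoids_powers_short_power_free (R : realType) (alpha : R) x :
  alpha <= 7 / 3 -> avoids_powers alpha x -> short_power_free x.
Proof.
move=> le_alpha avx a; split.
- exact: (avoids_powers_notin (y := [:: a]) (y' := [::]) (n := 3) le_alpha avx).
- apply: (avoids_powers_notin (y := [:: a; ~~ a]) (y' := [:: a]) (n := 2)
    le_alpha avx) => //.
  by rewrite /= eqxx.
- apply: (avoids_powers_notin (y := [:: ~~ a; a; a]) (y' := [:: ~~ a]) (n := 2)
    le_alpha avx) => //.
  by rewrite /= eqxx.
Qed.

(** * Counting *)

(** Plain words rather than tuples, so that words of different lengths can be
    concatenated in the covering argument below. *)
Definition avoiding_words (R : realType) (alpha : R) (n : nat) :
    seq (seq bool) :=
  [seq val w |
    w <- enum [pred w : n.-tuple bool | `[< avoids_powers alpha w >]]].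

Lemma size_avoiding_words (R : realType) (alpha : R) n :
  size (avoiding_words alpha n) = num_avoiding bool alpha n.
Proof. by rewrite size_map -cardE. Qed.

Lemma uniq_avoiding_words (R : realType) (alpha : R) n :
  uniq (avoiding_words alpha n).
Proof. by rewrite map_inj_uniq ?enum_uniq //; apply: val_inj. Qed.

Lemma mem_avoiding_words (R : realType) (alpha : R) n x :
  x \in avoiding_words alpha n <-> size x = n /\ avoids_powers alpha x.
Proof.
split=> [/mapP[w]|[<- avx]].
  by rewrite mem_enum => /asboolP avw ->; split; first exact: size_tuple.
rewrite -[x in x \in _]/(val (in_tuple x)) map_f // mem_enum.
exact/asboolP.
Qed.

Lemma avoids_powers_factorization (R : realType) (alpha : R) x :
  alpha <= 7 / 3 -> avoids_powers alpha x ->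
  exists u y v, [/\ u \in ends, v \in ends, avoids_powers alpha y &
    x = u ++ thue_morse y ++ v].
Proof.
move=> alpha_le avx.
have [u [z [u_end [y [v [v_end def_z]]] def_x]]] :=
  short_power_free_factored (avoids_powers_short_power_free alpha_le avx).
exists u, y, v; split; rewrite ?def_x ?def_z //.
apply/avoids_powers_thue_morse/(avoids_powers_infix _ avx).
by rewrite def_x def_z infix_infix.
Qed.

(** The words of length n are covered by the concatenations u mu(y) v, where
    the 25 pairs of ends (u, v) determine the length of y.  Pairs whose
    total length exceeds n or has the wrong parity contribute words of another
    length, which do no harm to an upper bound; so the rounding in the halving
    and the truncation in the subtraction are acceptable. *)
Lemma num_avoiding_le (R : realType) (alpha : R) n (m : nat) :
  alpha <= 7 / 3 ->
  (forall k, (k <= n./2)%N -> (num_avoiding bool alpha k <= m)%N) ->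
  (num_avoiding bool alpha n <= 25 * m)%N.
Proof.
move=> alpha_le le_m.
pose pairs := [seq (u, v) | u <- ends, v <- ends].
pose middle (e : seq bool * seq bool) :=
  avoiding_words alpha (n - (size e.1 + size e.2))./2.
pose cover := [seq e.1 ++ thue_morse y ++ e.2 | e <- pairs, y <- middle e].
have sub : {subset avoiding_words alpha n <= cover}.
  move=> x /mem_avoiding_words[sz_x avx].
  have [u [y [v [u_end v_end avy def_x]]]] :=
    avoids_powers_factorization alpha_le avx.
  apply/allpairsPdep; exists (u, v), y; split => //.
    exact: allpairs_f.
  apply/mem_avoiding_words; split=> //=.
  by rewrite -sz_x def_x !size_cat size_thue_morse addnCA addnK doubleK.
rewrite -size_avoiding_words.
apply: leq_trans (uniq_leq_size (uniq_avoiding_words alpha n) sub) _.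
rewrite size_allpairs_dep -[25%N]/(size pairs).
elim: (pairs) => //= e s IH; rewrite mulSn leq_add //.
by rewrite size_avoiding_words le_m // half_leq // leq_subr.
Qed.

(** Bounding all lengths below 2 ^ k at once makes the recursion usable without
    any monotonicity of the counting function. *)
Lemma num_avoiding_lt_exp2 (R : realType) (alpha : R) k n :
  alpha <= 7 / 3 -> (n < 2 ^ k)%N -> (num_avoiding bool alpha n <= 25 ^ k)%N.
Proof.
move=> alpha_le; elim: k n => [|k IH] n lt_n.
  have -> : n = 0%N by case: n lt_n.
  by rewrite (leq_trans (max_card _)) // card_tuple.
rewrite expnS; apply: num_avoiding_le => // j le_j; apply: IH.
by apply: leq_ltn_trans le_j _; rewrite ltn_half_double -mul2n -expnS.
Qed.

(** * Asymptotics *)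

(** Kept generic in the numbers: instances with large exponents must never be
    expanded into unary arithmetic. *)
Lemma ln_ratio_le (R : realType) (a b p q : nat) :
  (1 < b)%N -> (0 < a)%N -> (0 < p)%N -> (a ^ p <= b ^ q)%N ->
  ln a%:R / ln b%:R <= q%:R / p%:R :> R.
Proof.
move=> b_gt1 a_gt0 p_gt0 le_pow.
have ln_b_gt0 : 0 < ln b%:R :> R by rewrite ln_gt0 // ltr1n.
rewrite ler_pdivrMr // mulrAC ler_pdivlMr ?ltr0n // mulr_natr mulr_natl.
rewrite -!lnXn ?ltr0n //; last exact: ltnW.
by rewrite ler_ln ?posrE ?exprn_gt0 ?ltr0n // -?natrX ?ler_nat // ltnW.
Qed.

Lemma log2_25_le (R : realType) : ln 25 / ln 2 <= 4644 / 1000 :> R.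
Proof.
have -> : 4644 / 1000 = 1161%:R / 250%:R :> R by lra.
apply: ln_ratio_le; [by []|by []|by []|lia].
Qed.

Lemma num_avoiding_powR (R : realType) (alpha : R) n :
  alpha <= 7 / 3 -> (0 < n)%N ->
  (num_avoiding bool alpha n)%:R <= 25 * n%:R `^ (ln 25 / ln 2) :> R.
Proof.
move=> le_alpha n_gt0.
have /andP[le_n lt_n] := trunc_log_bounds (isT : (1 < 2)%N) n_gt0.
set t := trunc_log 2 n in le_n lt_n.
have ln2_gt0 : 0 < ln 2 :> R by rewrite ln_gt0 // ltr1n.
have exp25 : 25 ^+ t = (2 ^ t)%N%:R `^ (ln 25 / ln 2) :> R.
  rewrite natrX -[2 ^+ t]powR_mulrn // powRAC powR_mulrn ?powR_ge0 //.
  congr (_ ^+ _); rewrite /powR pnatr_eq0 /= mulfVK ?gt_eqF // lnK // posrE //.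
apply: (@le_trans _ _ (25 ^ t.+1)%N%:R).
  by rewrite ler_nat num_avoiding_lt_exp2.
rewrite natrX exprS ler_pM2l // exp25 ge0_ler_powR ?nnegrE ?ler_nat //.
by rewrite divr_ge0 // ln_ge0 // ler1n.
Qed.

Theorem theorem7 (R : realType) (alpha : R)
    (alpha_gt2 : 2 < alpha) (alpha_le : alpha <= 7 / 3) :
  ((fun n : nat => (num_avoiding bool alpha n)%:R : R) =O_\oo
     (fun n : nat => (n%:R : R) `^ (ln 25 / ln 2))) /\
  ((fun n : nat => (n%:R : R) `^ (ln 25 / ln 2)) =O_\oo
     (fun n : nat => (n%:R : R) `^ (4644 / 1000))).
Proof.
split.
  apply/eqO_exP; exists 25 => //; exists 1%N => // n /= n_gt0.
  by rewrite normr_nat ger0_norm ?powR_ge0 // num_avoiding_powR.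
apply/eqO_exP; exists 1 => //; exists 1%N => // n /= n_gt0.
by rewrite mul1r !ger0_norm ?powR_ge0 // ler_powR ?ler1n // log2_25_le.
Qed.
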